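(* Let $w$ be a recurrent aperiodic infinite binary word over the alphabet $\{0,1\}$. Then the following are equivalent: (1) $w$ is Sturmian. (2) For all factors $v,v'$ of $w$ of equal length, if $v<_{\mathrm{lex}}v'$ then $|v|_1\le |v'|_1$. (3) For any pair $v,v'$ of lexicographically consecutive factors of $w$ of the same length, $v$ and $v'$ differ in at most two positions.
   Context: The alphabet is ordered by $0<1$. A factor of $w$ is a finite word occurring as a block of consecutive letters of $w$; $\mathrm{Fact}(w)$ is the set of factors. $|v|_1$ is the number of occurrences of the letter $1$ in $v$. For finite words, $v<_{\mathrm{lex}}v'$ means $|v|=|v'|$ and there are a word $\lambda$ and letters $a<b$ such that $\lambda a$ is a prefix of $v$ and $\lambda b$ is a prefix of $v'$. Two factors $v,v'$ of $w$ are lexicographically consecutive (written $v'=\mathrm{succ}_w(v)$) if $v<_{\mathrm{lex}}v'$ and there is no $f\in\mathrm{Fact}(w)$ with $v<_{\mathrm{lex}}f<_{\mathrm{lex}}v'$. An infinite word is recurrent if each of its factors occurs infinitely often in it. It is aperiodic if it is not ultimately periodic, i.e. it has no tail of the form $v^\omega=vvv\cdots$ with $v$ a nonempty finite word. An infinite word $w$ is Sturmian if for every $n\ge 0$ it has exactly $n+1$ distinct factors of length $n$ (equivalently, $w$ is a binary aperiodic word such that for any two factors $u,u'$ of equal length and each letter $x$, the numbers of occurrences of $x$ in $u$ and in $u'$ differ by at most $1$). *)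

(* Defs.v *)
From mathcomp Require Import all_boot all_order.
From mathcomp Require Import boolp.

Set Implicit Arguments.
Unset Strict Implicit.
Unset Printing Implicit Defensive.

(* Letters are booleans: 0 is false, 1 is true, and (false < true)%O. *)
Definition infword := nat -> bool.

Definition block (w : infword) (i n : nat) : seq bool :=
  mkseq (fun j => w (i + j)) n.

Definition occurs_at (w : infword) (v : seq bool) (i : nat) : Prop :=
  block w i (size v) = v.

Definition factor (w : infword) (v : seq bool) : Prop :=
  exists i : nat, occurs_at w v i.

Definition lex_lt (v v' : seq bool) : Prop :=
  size v = size v' /\
  exists (l : seq bool) (a b : bool),
    [/\ (a < b)%O, prefix (rcons l a) v & prefix (rcons l b) v'].

Definition lex_succ (w : infword) (v v' : seq bool) : Prop :=
  [/\ factor w v, factor w v', lex_lt v v' &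
      ~ exists f : seq bool, [/\ factor w f, lex_lt v f & lex_lt f v']].

Definition recurrent (w : infword) : Prop :=
  forall v : seq bool, factor w v ->
    forall N : nat, exists i : nat, N <= i /\ occurs_at w v i.

Definition ultimately_periodic (w : infword) : Prop :=
  exists (v : seq bool) (N : nat),
    v <> [::] /\ forall i : nat, w (N + i) = nth false v (i %% size v).

Definition aperiodic (w : infword) : Prop := ~ ultimately_periodic w.

Definition sturmian (w : infword) : Prop :=
  forall n : nat, #|[set v : n.-tuple bool | `[< factor w v >]]| = n.+1.

(* zip truncates to the shorter word, so this is the number of positions where
   v and v' differ only when they have the same length. *)
Definition hamming (v v' : seq bool) : nat :=
  count (fun p : bool * bool => p.1 != p.2) (zip v v').

(* Main.v *)
(** All three conditions are equivalent to balance.  Write c(i, n) for the number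
    of 1s in the block of length n at i.

    The identity c(i+k, m) - c(i, m) = c(i+m, k) - c(i, k) links (2), about the
    sign of the left side, to balance, about how far the values of c(_, k)
    spread.  Balance gives (2) at once; conversely, if c(_, k) took three
    values, recurrence would make the right side change sign for fixed i and k.

    Let the height of a block be the sum of its prefix counts.  In a balanced
    word it is strictly increasing for the lexicographic order, and the heights
    of the factors of length n lie in a window of n + 1 integers.  By
    aperiodicity there are at least n + 1 factors, so they fill the window: this
    gives (1), and consecutive factors have exactly one differing prefix count,
    which gives (3).  Condition (3) gives (2) by chaining consecutive factors.

    Finally, in an unbalanced word of complexity n + 1, a shortest unbalanced
    pair is 0u0, 1u1, and one of 0u, 1u is the right special factor of its
    length; after an occurrence of the other word of the pair it is avoided long
    enough to force periodicity. *)

Require Import Defs.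
From mathcomp Require Import all_boot all_order.
From mathcomp Require Import boolp zify.

Set Implicit Arguments.
Unset Strict Implicit.
Unset Printing Implicit Defensive.

Import Order.TTheory.

(** * Lexicographic order and Hamming distance of finite words *)

(** Transitivity and totality are inherited from the library order through this bridge. *)
Lemma seq_bool_lexE (v v' : seq bool) : size v = size v' ->
  lex_lt v v' <-> ((v : seqlexi bool) < v')%O.
Proof.
elim: v v' => [|a v IHv] [|b v'] //=.
  by rewrite ltxx; split=> // -[_ [[|? ?] [? [? []]]]].
move=> [size_eq]; rewrite ltxi_cons; split.
  case=> _ [[|x l] [a' [b' [ltab]]]] /=.
    by move=> /andP[/eqP<- _] /andP[/eqP<- _]; case: a' b' ltab => -[].
  move=> /andP[/eqP<- pv] /andP[/eqP<- pv']; rewrite lexx /=.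
  by apply/(IHv v' size_eq); split=> //; exists l, a', b'.
case: (ltgtP a b) => [ltab _|//|<- /=].
  by split=> /=; [rewrite size_eq|exists [::], a, b; rewrite /= !eqxx !prefix0s].
move/(IHv v' size_eq) => [_ [l [a' [b' [ltab pv pv']]]]].
split=> /=; first by rewrite size_eq.
by exists (a :: l), a', b'; rewrite /= eqxx.
Qed.

Lemma lex_lt_trans (u v z : seq bool) : lex_lt u v -> lex_lt v z -> lex_lt u z.
Proof.
move=> uv vz; case: (uv) (vz) => suv _ [svz _].
move: uv vz => /(seq_bool_lexE suv) uv /(seq_bool_lexE svz) vz.
by apply/(seq_bool_lexE (etrans suv svz)); apply: lt_trans vz.
Qed.

Lemma lex_lt_irr (v : seq bool) : ~ lex_lt v v.
Proof. by move/(seq_bool_lexE erefl); rewrite ltxx. Qed.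

Lemma lex_lt_total (v v' : seq bool) : size v = size v' -> v <> v' ->
  lex_lt v v' \/ lex_lt v' v.
Proof.
move=> size_eq /eqP neq.
have := @lt_total _ (seqlexi bool) v v' neq.
by case/orP => [/(seq_bool_lexE size_eq)|/(seq_bool_lexE (esym size_eq))]; [left|right].
Qed.

Lemma count_le_hamming (x y : seq bool) : size x = size y ->
  count_mem true x <= count_mem true y + hamming x y.
Proof.
rewrite /hamming; elim: x y => [|a x IHx] [|b y] //= [/IHx].
by case: a b => -[] /=; lia.
Qed.

(** The first difference gains a 1, and at most one later difference can take it back. *)
Lemma lex_lt_hamming (v v' : seq bool) : lex_lt v v' -> hamming v v' <= 2 ->
  count_mem true v <= count_mem true v'.
Proof.
move=> [size_eq [l [a [b [ltab /prefixP[x vE] /prefixP[y v'E]]]]]].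
move: size_eq; rewrite {}vE {}v'E !cat_rcons !size_cat /= => /addnI[size_eq].
have := count_le_hamming size_eq.
rewrite /hamming zip_cat // !count_cat /=.
case: a b ltab => -[] //= _; lia.
Qed.

(** * Blocks of an infinite word and their numbers of 1s *)

Section Word.

Variable w : infword.

Definition ones (i n : nat) : nat := count_mem true (block w i n).

Lemma size_block (i n : nat) : size (block w i n) = n.
Proof. exact: size_mkseq. Qed.

Lemma blockS (i n : nat) : block w i n.+1 = rcons (block w i n) (w (i + n)).
Proof. exact: mkseqS. Qed.

Lemma block_add (i m n : nat) :
  block w i (m + n) = block w i m ++ block w (i + m) n.
Proof.
elim: n => [|n IHn]; first by rewrite addn0 cats0.
by rewrite addnS !blockS IHn rcons_cat addnA.
Qed.

Lemma block_eqP (i j n : nat) :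
  block w i n = block w j n <-> (forall m, m < n -> w (i + m) = w (j + m)).
Proof.
split=> [eq_b m lt_mn|eq_w].
  by move/(congr1 (nth false ^~ m)): eq_b; rewrite /= !nth_mkseq.
apply: (@eq_from_nth _ false); rewrite !size_block // => m lt.
by rewrite !nth_mkseq ?eq_w.
Qed.

Lemma ones0 (i : nat) : ones i 0 = 0. Proof. by []. Qed.

Lemma onesS (i n : nat) : ones i n.+1 = ones i n + w (i + n).
Proof. by rewrite /ones blockS -cats1 count_cat /= addn0; case: (w _). Qed.

Lemma ones_add (i m n : nat) : ones i (m + n) = ones i m + ones (i + m) n.
Proof. by rewrite /ones block_add count_cat. Qed.

Lemma onesSl (i n : nat) : ones i n.+1 = w i + ones i.+1 n.
Proof. by rewrite -add1n ones_add addn1 onesS ones0 addn0. Qed.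

Lemma factor_block (i n : nat) : factor w (block w i n).
Proof. by exists i; rewrite /occurs_at size_block. Qed.

Lemma factorP (v : seq bool) : factor w v -> exists i, v = block w i (size v).
Proof. by case=> i vE; exists i. Qed.

(** First difference of the suffixes at i and j. No block length occurs, so comparisons made at
    different lengths can be confronted. *)
Definition lex_at (i j d : nat) : Prop :=
  [/\ block w i d = block w j d, w (i + d) = false & w (j + d) = true].

Lemma prefix_block (l : seq bool) (i n : nat) :
  prefix l (block w i n) -> l = block w i (size l).
Proof.
move=> pl; have := size_prefix pl; rewrite size_block => le_n.
move: pl; rewrite prefixE => /eqP {1}<-.
by rewrite -{1}(subnKC le_n) block_add take_size_cat ?size_block.
Qed.

Lemma lex_lt_block (i j n : nat) :
  lex_lt (block w i n) (block w j n) -> exists2 d, d < n & lex_at i j d.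
Proof.
case=> _ [l [a [b [ltab pi pj]]]]; exists (size l).
  by have := size_prefix pi; rewrite size_rcons size_block.
move/prefix_block: pi; move/prefix_block: pj.
rewrite !size_rcons !blockS => /rcons_inj[lj bE] /rcons_inj[li aE].
by case: a b ltab aE bE => -[] // _ aE bE; split=> //; rewrite -li -lj.
Qed.

(** * Balance and monotonicity of the number of 1s *)

Definition balanced : Prop := forall i j n, ones i n <= (ones j n).+1.

Definition ones_lex_mono : Prop :=
  forall v v' : seq bool, factor w v -> factor w v' -> size v = size v' ->
    lex_lt v v' -> count_mem true v <= count_mem true v'.

(* Exchanges a comparison of the prefix counts of length m at i and i + n for a
   comparison of the windows of length n at i and i + m. *)
Lemma ones_swap (i m n : nat) :
  ones i m + ones (i + m) n = ones i n + ones (i + n) m.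
Proof. by rewrite -!ones_add addnC. Qed.

(** The prefix counts at j lead by 1 at d + 1. Falling behind at a later m would, by [ones_swap],
    give two windows of length |i - j| whose counts differ by at least 2. *)
Lemma balanced_lex_at (i j d m : nat) : balanced -> lex_at i j d ->
  ones i m + (m == d.+1) <= ones j m.
Proof.
move=> bal [eq_d wi wj].
have onesd : ones i d = ones j d by rewrite /ones eq_d.
have onesd1 : (ones i d.+1).+1 = ones j d.+1 by rewrite !onesS onesd wi wj; lia.
have [->|neq_m] := eqVneq m d.+1; first by lia.
have [lt_md|le_dm] := ltnP m d.+1.
  suff -> : ones i m = ones j m by lia.
  by rewrite /ones (_ : block w i m = block w j m) //; apply/block_eqP => k lt_k;
    apply: (iffLR (block_eqP i j d)) => //; lia.
have [le_ij|lt_ji] := leqP i j.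
  have := bal (i + d.+1) (i + m) (j - i).
  have := ones_swap i m (j - i); have := ones_swap i d.+1 (j - i).
  by rewrite subnKC //; lia.
have := bal (j + m) (j + d.+1) (i - j).
have := ones_swap j m (i - j); have := ones_swap j d.+1 (i - j).
by rewrite subnKC //; lia.
Qed.

Lemma balanced_ones_lex_mono : balanced -> ones_lex_mono.
Proof.
move=> bal v v' /factorP[i ->] /factorP[j ->]; rewrite !size_block => <-.
move=> /lex_lt_block[d _ lex_d].
by have := balanced_lex_at (size v) bal lex_d; rewrite /ones; lia.
Qed.

Lemma ones_step (i k : nat) : ones i.+1 k <= (ones i k).+1.
Proof.
by have := onesS i k; have := onesSl i k; case: (w i) (w (i + k)) => -[] /=; lia.
Qed.

(** Discrete intermediate values: sliding a window by one letter adds at most one 1. *)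
Lemma ones_attained (i j k : nat) : ones j k < ones i k -> j <= i ->
  exists2 h, j <= h & ones h k = (ones j k).+1.
Proof.
move=> lt_ji le_ji; rewrite -(subnKC le_ji) in lt_ji *.
elim: (i - j) lt_ji => [|n IHn]; first by rewrite addn0; lia.
rewrite addnS => lt_n; have step := ones_step (j + n) k.
have [/IHn//|ge_n] := ltnP (ones j k) (ones (j + n) k).
by exists (j + n).+1; lia.
Qed.

Lemma ones_recurrent (i k N : nat) : recurrent w ->
  exists2 h, N <= h & ones h k = ones i k.
Proof.
move=> /(_ _ (factor_block i k) N)[h [le_h]].
by rewrite /occurs_at size_block => eq_h; exists h; rewrite // /ones eq_h.
Qed.

Lemma mono_ones (h h' m : nat) : ones_lex_mono -> ones h' m < ones h m ->
  exists2 d, d < m & lex_at h' h d.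
Proof.
move=> mono lt_m; apply: lex_lt_block.
have neq : block w h m <> block w h' m by move=> eq_b; move: lt_m; rewrite /ones eq_b ltnn.
have [||//] := lex_lt_total _ neq; first by rewrite !size_block.
move/(mono _ _ (factor_block _ _) (factor_block _ _)).
by rewrite !size_block -/(ones h m) -/(ones h' m) => /(_ erefl); lia.
Qed.

(* If windows of length k took three values, then, by recurrence, starting from
   the middle one the difference of the prefix counts at h and h + k would take
   both signs, so these two suffixes could not be compared. *)
Lemma ones_lex_mono_balanced : recurrent w -> ones_lex_mono -> balanced.
Proof.
move=> rec mono i j k; rewrite leqNgt; apply/negP => lt_ji.
have [i' le_i' eq_i'] := ones_recurrent i k j rec.
have [h _ eq_h] : exists2 h, j <= h & ones h k = (ones j k).+1.
  by apply: ones_attained le_i'; lia.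
have [h1 le_h1 eq_h1] := ones_recurrent j k h rec.
have [h2 le_h2 eq_h2] := ones_recurrent i k h rec.
have := ones_swap h k (h1 - h); have := ones_swap h k (h2 - h).
rewrite !subnKC // => sw2 sw1.
have [|d1 _ [eq1 lt1 gt1]] := @mono_ones h (h + k) (h1 - h) mono; first by lia.
have [|d2 _ [eq2 lt2 gt2]] := @mono_ones (h + k) h (h2 - h) mono; first by lia.
have [lt_d|lt_d|eq_d] := ltngtP d1 d2.
- by move: lt1; rewrite -(iffLR (block_eqP _ _ _) eq2) // gt1.
- by move: lt2; rewrite -(iffLR (block_eqP _ _ _) eq1) // gt2.
- by move: lt1; rewrite eq_d gt2.
Qed.

(** * Determinism, right special factors and complexity *)

(* A stretch of the word along which each block determines the next letter and
   which returns to its initial block is repeated forever. *)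
Lemma deterministic_periodic (n i j : nat) : i < j ->
  block w i n = block w j n ->
  (forall m m', i <= m < j -> block w m n = block w m' n -> w (m + n) = w (m' + n)) ->
  ultimately_periodic w.
Proof.
move=> lt_ij eq_ij det; set d := j - i.
have d_gt0 : 0 < d by rewrite /d; lia.
have per t : block w (i + t %% d) n = block w (i + t) n.
  elim: t => [|t IHt]; first by rewrite mod0n.
  have lt_d := ltn_pmod t d_gt0.
  have eqS : block w (i + (t %% d).+1) n = block w (i + t.+1) n.
    have : block w (i + t %% d) n.+1 = block w (i + t) n.+1.
      rewrite !blockS IHt (det (i + t %% d) (i + t)) //; rewrite /d in lt_d *; lia.
    rewrite -(add1n n) !block_add => /(congr1 behead) /=.
    by rewrite -!addnA !addn1.
  rewrite -eqS -addn1 -modnDml addn1.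
  have [eq_d|neq_d] := eqVneq (t %% d).+1 d.
    by rewrite eq_d modnn addn0 /d subnKC // ltnW.
  by rewrite modn_small //; lia.
exists (block w (i + n) d), (i + n); rewrite size_block; split.
  by move/(congr1 size); rewrite size_block /=; lia.
move=> t; have lt_d := ltn_pmod t d_gt0.
rewrite /block nth_mkseq // addnAC -(det (i + t %% d) (i + t)) //.
  by rewrite addnAC.
by rewrite /d in lt_d *; lia.
Qed.

Definition factors (n : nat) : {set n.-tuple bool} :=
  [set v : n.-tuple bool | `[< factor w v >]].

Definition right_special (n : nat) : {set n.-tuple bool} :=
  [set v : n.-tuple bool |
    `[< factor w (rcons v false) >] && `[< factor w (rcons v true) >]].

Definition tblock (i n : nat) : n.-tuple bool := [tuple of block w i n].

Lemma tblock_factors (i n : nat) : tblock i n \in factors n.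
Proof. by rewrite inE; apply/asboolP/factor_block. Qed.

Lemma factors_tblock (n : nat) (v : n.-tuple bool) :
  v \in factors n -> exists i, v = tblock i n.
Proof.
rewrite inE => /asboolP/factorP[i]; rewrite size_tuple => vE.
by exists i; apply: val_inj.
Qed.

Lemma factor_rconsP (n : nat) (v : n.-tuple bool) (b : bool) :
  factor w (rcons v b) <-> exists2 i, v = tblock i n & w (i + n) = b.
Proof.
split=> [/factorP[i]|[i -> <-]]; last by rewrite -blockS; apply: factor_block.
rewrite size_rcons size_tuple blockS => /rcons_inj[vE ->].
by exists i => //; apply: val_inj.
Qed.

(** With [A b] the words that can be followed by b, both sides equal |A 0| + |A 1|. *)
Lemma card_factorsS (n : nat) :
  #|factors n.+1| = #|factors n| + #|right_special n|.
Proof.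
pose A b := [set v : n.-tuple bool | `[< factor w (rcons v b) >]].
have -> : factors n = A false :|: A true.
  apply/setP => v; apply/idP/idP => [/factors_tblock[i ->]|].
    rewrite !inE; case E: (w (i + n)); apply/orP; [right|left];
    by apply/asboolP/factor_rconsP; exists i.
  rewrite !inE => /orP[] /asboolP/factor_rconsP[i -> _];
  by apply/asboolP/factor_block.
have -> : right_special n = A false :&: A true by apply/setP => v; rewrite !inE.
rewrite cardsUI.
pose ext b := fun v : n.-tuple bool => [tuple of rcons v b].
have ext_inj b : injective (ext b).
  by move=> u v /(congr1 val) /= /rcons_inj[/val_inj].
rewrite -(card_imset (A false) (ext_inj false)) -(card_imset (A true) (ext_inj true)).
rewrite -cardsUI.
have -> : (ext false @: A false) :&: (ext true @: A true) = set0.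
  apply/setP => v; rewrite !inE; apply/negP => /andP[/imsetP[x _ ->]].
  by case/imsetP => y _ /(congr1 val) /= /rcons_inj[].
rewrite cards0 addn0; apply: eq_card => v; apply/idP/idP.
  case/factors_tblock => i ->; rewrite inE.
  have inA : ext (w (i + n)) (tblock i n) \in ext (w (i + n)) @: A (w (i + n)).
    by apply: imset_f; rewrite inE; apply/asboolP/factor_rconsP; exists i.
  have -> : tblock i n.+1 = ext (w (i + n)) (tblock i n).
    by apply: val_inj; rewrite /= blockS.
  by case: (w (i + n)) inA => ->; rewrite ?orbT.
by rewrite !inE => /orP[] /imsetP[x]; rewrite inE => /asboolP fx ->; apply/asboolP.
Qed.

Lemma not_right_special_det (n m m' : nat) : tblock m n \notin right_special n ->
  block w m n = block w m' n -> w (m + n) = w (m' + n).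
Proof.
move=> nrs eq_m; apply/eqP; apply: contraNT nrs => neq; rewrite inE.
have fm : factor w (rcons (tblock m n) (w (m + n))) by apply/factor_rconsP; exists m.
have fm' : factor w (rcons (tblock m n) (w (m' + n))).
  by apply/factor_rconsP; exists m' => //; apply: val_inj.
by case: (w (m + n)) (w (m' + n)) neq fm fm' => -[] // _ f f';
  apply/andP; split; apply/asboolP.
Qed.

(** By pigeonhole a block of D repeats, and from one occurrence to the next every block determines
    its next letter. *)
Lemma window_periodic (n q N : nat) (D : {set n.-tuple bool}) : #|D| < N ->
  (forall m, q <= m < q + N -> tblock m n \in D /\ tblock m n \notin right_special n) ->
  ultimately_periodic w.
Proof.
move=> ltDN inD.
pose f (m : 'I_N) := tblock (q + m) n.
have /injectivePn[x [y neq_xy eq_f]] : ~~ injectiveb f.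
  apply/negP => /injectiveP f_inj; move: ltDN; rewrite ltnNge => /negP[].
  rewrite -[N]card_ord -cardsT -(card_imset _ f_inj); apply: subset_leq_card.
  by apply/subsetP => v /imsetP[m _ ->]; apply: (proj1 (inD _ _)); have := ltn_ord m; lia.
have {}neq_xy : x != y :> nat by [].
have {eq_f} eq_f : block w (q + x) n = block w (q + y) n by exact: (congr1 val eq_f).
wlog lt_xy : x y neq_xy eq_f / x < y => [wl|].
  have [lt|lt|eq] := ltngtP x y; first exact: (wl x y).
    by apply: (wl y x); rewrite // eq_sym.
  by rewrite eq eqxx in neq_xy.
apply: (@deterministic_periodic n (q + x) (q + y)) => //; first by lia.
move=> m m' m_in; apply: not_right_special_det; apply: (proj2 (inD _ _)).
by have := ltn_ord y; lia.
Qed.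

Lemma right_special_nonempty (n : nat) : aperiodic w -> 0 < #|right_special n|.
Proof.
move=> aper; rewrite lt0n cards_eq0; apply/negP => /eqP rs0; apply: aper.
apply: (@window_periodic n 0 #|factors n|.+1 (factors n)) => // m _.
by rewrite rs0 in_set0 tblock_factors.
Qed.

Lemma card_factors0 : #|factors 0| = 1.
Proof.
apply/eqP/cards1P; exists [tuple]; apply/setP => v.
by rewrite (tuple0 v) !inE eqxx; apply/asboolP; exists 0.
Qed.

(** The Morse-Hedlund bound: a right special factor at each length makes the complexity grow. *)
Lemma aperiodic_card_factors (n : nat) : aperiodic w -> n < #|factors n|.
Proof.
move=> aper; elim: n => [|n IHn]; first by rewrite card_factors0.
by rewrite card_factorsS; have := right_special_nonempty n aper; lia.
Qed.

(** * Heights of factors in a balanced word *)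

Definition height (v : seq bool) : nat :=
  \sum_(m < (size v).+1) count_mem true (take m v).

Lemma take_block (i m n : nat) : m <= n -> take m (block w i n) = block w i m.
Proof. by move=> le_mn; rewrite -(subnKC le_mn) block_add take_size_cat ?size_block. Qed.

Lemma height_block (i n : nat) :
  height (block w i n) = \sum_(m < n.+1) ones i m.
Proof.
rewrite /height size_block; apply: eq_bigr => m _.
by rewrite /ones take_block // -ltnS.
Qed.

Lemma height_lt (i j n : nat) : balanced ->
  lex_lt (block w i n) (block w j n) ->
  height (block w i n) < height (block w j n).
Proof.
move=> bal /lex_lt_block[d lt_dn lex_d]; rewrite !height_block.
have lt_d1 : d.+1 < n.+1 by [].
(* The prefix counts compare term by term, strictly at d + 1. *)
rewrite (bigD1 (Ordinal lt_d1)) //= [ltnRHS](bigD1 (Ordinal lt_d1)) //= -addSn.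
apply: leq_add; first by have := balanced_lex_at d.+1 bal lex_d; lia.
by apply: leq_sum => m _; have := balanced_lex_at m bal lex_d; lia.
Qed.

Lemma height_lex (i j n : nat) : balanced ->
  height (block w i n) < height (block w j n) ->
  lex_lt (block w i n) (block w j n).
Proof.
move=> bal lt_h; have neq : block w i n <> block w j n by move=> eq; rewrite eq ltnn in lt_h.
have [||/(height_lt bal)] := lex_lt_total _ neq => //; first by rewrite !size_block.
by lia.
Qed.

(** Each of the n nonempty prefixes contributes at most 1. *)
Lemma height_range (i j n : nat) : balanced ->
  height (block w j n) <= height (block w i n) + n.
Proof.
move=> bal; rewrite !height_block.
elim: n => [|n /= IHn]; first by rewrite !big_ord_recr !big_ord0.
by rewrite big_ord_recr [X in _ <= X + _]big_ord_recr /=; have := bal j i n.+1; lia.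
Qed.

Lemma height_window (n : nat) : balanced ->
  exists h0, forall i, h0 <= height (block w i n) <= h0 + n.
Proof.
move=> bal; have exH : exists h, `[< exists i, height (block w i n) = h >].
  by exists (height (block w 0 n)); apply/asboolP; exists 0.
have [h0 /asboolP[i0 hi0] min] := ex_minnP exH.
exists h0 => i; rewrite min /=; last by apply/asboolP; exists i.
by rewrite -hi0 height_range.
Qed.

(* The n.+1 or more factors of length n have distinct heights in a window of
   n.+1 integers, so they fill it. *)
Lemma height_factors (n : nat) : balanced -> aperiodic w ->
  #|factors n| = n.+1 /\
  forall i j h, height (block w i n) <= h <= height (block w j n) ->
    exists k, height (block w k n) = h.
Proof.
move=> bal aper; have [h0 win] := height_window n bal.
(* The default value of [inord] is never met on factors: their heights exceed h0 by at most n. *)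
pose f (v : n.-tuple bool) : 'I_n.+1 := inord (height v - h0).
have fE i : h0 + f (tblock i n) = height (block w i n).
  have /andP[le0 le_n] := win i.
  by rewrite /f inordK /= ?subnKC // ltnS leq_subLR.
have f_inj : {in factors n &, injective f}.
  move=> u v /factors_tblock[i ->] /factors_tblock[j ->] eq_f.
  have eq_h : height (block w i n) = height (block w j n) by rewrite -!fE eq_f.
  apply: val_inj => /=; apply: contrapT => neq.
  have := lex_lt_total _ neq; rewrite !size_block => /(_ erefl).
  by case=> /(height_lt bal); rewrite eq_h ltnn.
have cardf : #|f @: factors n| = #|factors n| by exact: card_in_imset.
have sizef := aperiodic_card_factors n aper.
have := max_card (mem (f @: factors n)); rewrite card_ord cardf => lef.
split=> [|i j h h_in]; first by lia.
have imT : f @: factors n = setT.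
  by apply/eqP; rewrite eqEcard subsetT cardsT card_ord cardf.
have lt_h : h - h0 < n.+1 by have := win j; lia.
have : Ordinal lt_h \in f @: factors n by rewrite imT inE.
case/imsetP => _ /factors_tblock[k ->] /(congr1 val) /= eq_k.
by exists k; rewrite -fE -eq_k; have := win i; lia.
Qed.

Lemma balanced_sturmian : balanced -> aperiodic w -> sturmian w.
Proof. by move=> bal aper n; case: (height_factors n bal aper). Qed.

(* Each change of the difference between prefix counts is a position where the
   two blocks differ. *)
Lemma hamming_height (i j n : nat) :
  (forall m, ones i m <= ones j m <= (ones i m).+1) ->
  hamming (block w i n) (block w j n) + 2 * height (block w i n) + ones j n
    <= 2 * height (block w j n) + ones i n.
Proof.
move=> le_ones; rewrite !height_block.
(* Let e m = ones j m - ones i m, which is 0 or 1. If the letters at offset n differ, exactly one of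
   e n, e (n + 1) is 1; the sum of e m + e (m + 1) over m < n is twice the height gap minus e n. *)
elim: n => [|n /= IHn]; first by rewrite !big_ord_recr !big_ord0.
rewrite big_ord_recr [X in _ <= 2 * X + _]big_ord_recr /=.
have -> : hamming (block w i n.+1) (block w j n.+1) =
          hamming (block w i n) (block w j n) + (w (i + n) != w (j + n)).
  by rewrite /hamming !blockS -!cats1 zip_cat ?size_block // count_cat /= addn0.
have := le_ones n; have := le_ones n.+1; rewrite !onesS.
by case: (w (i + n)) (w (j + n)) => -[] /=; lia.
Qed.

Lemma balanced_lex_succ_hamming (v v' : seq bool) : balanced -> aperiodic w ->
  lex_succ w v v' -> hamming v v' <= 2.
Proof.
move=> bal aper [/factorP[i ->] /factorP[j ->]].
set n := size v => lt_v; have size_eq : size v' = n.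
  by case: lt_v => + _; rewrite !size_block => ->.
rewrite size_eq in lt_v * => nobetween.
have [d _ lex_d] := lex_lt_block lt_v.
have ham : hamming (block w i n) (block w j n) + 2 * height (block w i n) + ones j n
    <= 2 * height (block w j n) + ones i n.
  apply: hamming_height => m.
  by have := balanced_lex_at m bal lex_d; have := bal j i m; lia.
have := balanced_lex_at n bal lex_d.
(* A height gap of 1 turns [ham] into the bound 2; a larger gap leaves room for a factor in
   between. *)
suff : height (block w j n) <= (height (block w i n)).+1 by lia.
rewrite leqNgt; apply/negP => lt_h; apply: nobetween.
have [_ /(_ i j (height (block w i n)).+1)[|k hk]] := height_factors n bal aper.
  by lia.
exists (block w k n); split; first exact: factor_block.
  by apply: height_lex => //; rewrite hk.
by apply: height_lex => //; rewrite hk.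
Qed.

(** * Chaining consecutive factors *)

(** Induction on the number of factors strictly between: such a factor splits the interval into two
    that no longer contain it. *)
Lemma lex_succ_hamming_mono :
  (forall v v' : seq bool, size v = size v' -> lex_succ w v v' ->
     hamming v v' <= 2) ->
  ones_lex_mono.
Proof.
move=> ham u u' fu fu' size_u; set n := size u in size_u.
pose between (x y : seq bool) := [set f : n.-tuple bool |
  `[< [/\ factor w f, lex_lt x f & lex_lt f y] >]].
suff mono N (v v' : n.-tuple bool) : #|between v v'| < N ->
    factor w v -> factor w v' -> lex_lt v v' -> count_mem true v <= count_mem true v'.
  have size_u' : size u' == n by rewrite -size_u.
  exact: (mono _ (in_tuple u) (Tuple size_u') (ltnSn _)).
elim: N v v' => // N IHN v v' ltN fv fv' lt_v.
have [[f [ff lt_vf lt_fv']]|nobetween] :=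
  pselect (exists f : seq bool, [/\ factor w f, lex_lt v f & lex_lt f v']); last first.
  by apply: lex_lt_hamming => //; apply: ham; rewrite ?size_tuple.
have size_f : size f == n by case: lt_vf => + _; rewrite size_tuple => <-.
pose t : n.-tuple bool := Tuple size_f.
have shrink x y : ~ lex_lt x t \/ ~ lex_lt t y -> between x y \subset between v v' ->
    #|between x y| < N.
  move=> not_in sub; rewrite -ltnS; apply: leq_trans ltN; rewrite ltnS.
  apply: proper_card; apply/properP; split=> //.
  exists t; first by rewrite inE; apply/asboolP.
  by rewrite inE; apply/negP => /asboolP[_ ? ?]; case: not_in.
apply: (@leq_trans (count_mem true t)); apply: IHN => //; apply: shrink.
- by right; apply: lex_lt_irr.
- apply/subsetP => g; rewrite !inE => /asboolP[fg lt_g g_lt]; apply/asboolP; split=> //.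
  exact: lex_lt_trans g_lt lt_fv'.
- by left; apply: lex_lt_irr.
- apply/subsetP => g; rewrite !inE => /asboolP[fg lt_g g_lt]; apply/asboolP; split=> //.
  exact: lex_lt_trans lt_vf lt_g.
Qed.

(** * Sturmian words are balanced *)

(** The complexity grows by exactly 1, which is the number of right special words. *)
Lemma sturmian_right_special_uniq (n : nat) (u v : n.-tuple bool) : sturmian w ->
  u \in right_special n -> v \in right_special n -> u = v.
Proof.
move=> st; have := card_factorsS n; rewrite [#|factors _|]st [#|factors _|]st => card_rs.
have /cards1P[r ->] : #|right_special n| == 1 by apply/eqP; lia.
by rewrite !inE => /eqP-> /eqP->.
Qed.

Lemma right_specialP (n : nat) (i j : nat) : block w i n = block w j n ->
  w (i + n) != w (j + n) -> tblock i n \in right_special n.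
Proof.
move=> eq_b neq; apply/negPn/negP => /not_right_special_det/(_ eq_b) eq_w.
by rewrite eq_w eqxx in neq.
Qed.

Lemma blockSl (i n : nat) : block w i n.+1 = w i :: block w i.+1 n.
Proof. by rewrite -add1n block_add addn1 /block /= addn0. Qed.

(* The word reads b u b at q and b' u b' at q', with b' <> b, and b' u is right
   special.  After q the block b' u cannot start before position q + n + 2, as
   the shorter words b s b and b' s b' would then be an unbalanced pair; hence
   the n + 2 windows from q on avoid b' u, and there are n + 1 other factors. *)
Lemma unbalanced_periodic (q q' n : nat) : sturmian w ->
  (forall m i j, m < n.+2 -> ones i m <= (ones j m).+1) ->
  w q != w q' -> block w q.+1 n = block w q'.+1 n ->
  w (q + n.+1) = w q -> w (q' + n.+1) = w q' ->
  tblock q' n.+1 \in right_special n.+1 -> ultimately_periodic w.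
Proof.
move=> st bal neq eq_u wq wq' rs.
have eq_w m : 0 < m <= n -> w (q + m) = w (q' + m).
  by case: m => // m /= lt_m; rewrite -!addSnnS; apply: (iffLR (block_eqP _ _ _) eq_u).
have avoid p : p < n.+2 -> block w (q + p) n.+1 <> block w q' n.+1.
  case: p => [_ eq_b|p lt_p eq_b].
    by move: eq_b neq; rewrite addn0 !blockSl => -[-> _]; rewrite eqxx.
  have eq_bm := iffLR (block_eqP _ _ _) eq_b.
  have wp : w (q + p.+1) = w q' by rewrite -(addn0 (_ + _)) eq_bm // addn0.
  have lt_pn : p < n.
    rewrite ltn_neqAle -ltnS -[p < _]ltnS lt_p andbT; apply: contraNneq neq => eq_p.
    by rewrite -wq -wp eq_p.
  (* The unbalanced pair has length n - p + 1: b s b starts at q, and b' s b' at q' + p + 1 ends b'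
     u b'. *)
  have lastq : w (q + (n - p)) = w q.
    rewrite eq_w; last by lia.
    by rewrite -eq_bm; [rewrite -wq; congr w|]; lia.
  have lastq' : w (q' + p.+1 + (n - p)) = w q' by rewrite -wq'; congr w; lia.
  have firstq' : w (q' + p.+1) = w q' by rewrite -eq_w.
  have inner : ones q.+1 (n - p).-1 = ones (q' + p.+1).+1 (n - p).-1.
    rewrite /ones (_ : block w _ _ = block w (q' + p.+1).+1 (n - p).-1) //.
    apply/block_eqP => m lt_m.
    rewrite addSnnS eq_w -?eq_bm; [|lia|lia].
    rewrite (_ : _.+1 + m = q' + (p + m.+2)); last by lia.
    by rewrite -eq_w; [congr w|]; lia.
  have ends k : ones k (n - p).-1.+2 = w k + ones k.+1 (n - p).-1 + w (k + (n - p)).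
    by rewrite onesS onesSl; congr (_ + w _); lia.
  have := bal (n - p).-1.+2 q (q' + p.+1); have := bal (n - p).-1.+2 (q' + p.+1) q.
  rewrite !ends inner lastq lastq' firstq'.
  by move: neq; case: (w q) (w q') => -[] //= _; lia.
apply: (@window_periodic n.+1 q n.+2 (factors n.+1 :\ tblock q' n.+1)).
  have : #|factors n.+1| = n.+2 by exact: st.
  by rewrite (cardsD1 (tblock q' n.+1)) tblock_factors add1n => -[->].
move=> m m_in; have neq_t : tblock m n.+1 != tblock q' n.+1.
  apply/eqP => /(congr1 val) /=; rewrite -(subnKC (proj1 (andP m_in))).
  by apply: avoid; lia.
split; first by rewrite in_setD1 neq_t tblock_factors.
by apply: contra neq_t => rsm; apply/eqP/(sturmian_right_special_uniq st).
Qed.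

Lemma sturmian_balanced : sturmian w -> aperiodic w -> balanced.
Proof.
move=> st aper i j k; elim/ltn_ind: k i j => k bal i j.
rewrite leqNgt; apply/negP => lt_ji.
case: k => [|[|n]] in bal lt_ji.
- by rewrite !ones0 in lt_ji.
- by rewrite !onesS !ones0 in lt_ji; case: (w _) (w _) lt_ji => -[].
have {}bal m i' j' : m < n.+2 -> ones i' m <= (ones j' m).+1 by move/bal; apply.
(* The total excess is at least 2, while a proper prefix and the remaining suffix give at most 1
   each. Hence the blocks are 1u1 at i and 0u0 at j. *)
have excess m : 0 < m < n.+2 -> ones i m = (ones j m).+1.
  move=> m_in; have bal1 := bal m i j; have bal2 := bal (n.+2 - m) (i + m) (j + m).
  have := ones_add i m (n.+2 - m); have := ones_add j m (n.+2 - m).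
  by rewrite subnKC; lia.
have first_l := excess 1; have last_l := excess n.+1.
have [wi wj] : w i = true /\ w j = false.
  by move: first_l; rewrite !onesS !ones0 !addn0; case: (w i) (w j) => -[] /(_ isT).
have [wi' wj'] : w (i + n.+1) = true /\ w (j + n.+1) = false.
  move: lt_ji; rewrite !(onesS _ n.+1) last_l ?ltnSn //.
  by case: (w (i + _)) (w (j + _)) => -[] /=; lia.
have eq_u : block w i.+1 n = block w j.+1 n.
  apply/block_eqP => m lt_m; have := excess m.+1; have := excess m.+2.
  rewrite !addSnnS !(onesS _ m.+1).
  by case: (w (i + _)) (w (j + _)) => -[] //=; lia.
have [r rsr] : exists r, r \in right_special n.+1.
  by apply/set0Pn; rewrite -card_gt0; apply: right_special_nonempty.
have [h rE] : exists h, r = tblock h n.+1.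
  move: rsr; rewrite inE => /andP[/asboolP/factor_rconsP[h -> _] _].
  by exists h.
have [h' eq_h neq_h] : exists2 h', block w h n.+1 = block w h' n.+1 &
    w (h + n.+1) != w (h' + n.+1).
  move: rsr; rewrite inE => /andP[/asboolP/factor_rconsP[h1 r1 w1]].
  move=> /asboolP/factor_rconsP[h2 r2 w2].
  move: r1 r2; rewrite rE => /(congr1 val) /= eq1 /(congr1 val) /= eq2.
  case wh : (w (h + n.+1)); first by exists h1; rewrite ?w1.
  by exists h2; rewrite ?w2.
(* The tail of r and u are both right special of length n, hence equal: r is 0u or 1u. *)
have rs_h : tblock h.+1 n \in right_special n.
  move: eq_h; rewrite !blockSl => -[_ eq_h].
  by apply: right_specialP eq_h _; rewrite !addSnnS.
have rs_u : tblock i.+1 n \in right_special n.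
  by apply: right_specialP eq_u _; rewrite !addSnnS wi' wj'.
have eq_hi : block w h.+1 n = block w i.+1 n.
  exact: (congr1 val (sturmian_right_special_uniq st rs_h rs_u)).
have r_start k : w h = w k -> block w h.+1 n = block w k.+1 n ->
    tblock k n.+1 \in right_special n.+1.
  move=> wk eq_k; rewrite -(_ : r = tblock k n.+1) //.
  by rewrite rE; apply: val_inj; rewrite /= !blockSl wk eq_k.
(* If r is 1u, the avoiding windows start at 0u0, and conversely. *)
apply: aper; case wh : (w h).
  apply: (@unbalanced_periodic j i n) => //; rewrite ?wi ?wj //.
  by apply: r_start; rewrite ?wi.
apply: (@unbalanced_periodic i j n) => //; rewrite ?wi ?wj //.
by apply: r_start; rewrite ?wj // eq_hi.
Qed.

End Word.

Theorem theorem1p2 (w : infword) (hrec : recurrent w) (haper : aperiodic w) :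
  [<-> sturmian w;
       forall v v' : seq bool, factor w v -> factor w v' -> size v = size v' ->
         lex_lt v v' -> count_mem true v <= count_mem true v';
       forall v v' : seq bool, size v = size v' -> lex_succ w v v' ->
         hamming v v' <= 2].
Proof.
(* The cycle is (1) to (2) to (3) to (1), each arrow passing through balance. *)
split; first by move=> st; apply/balanced_ones_lex_mono/sturmian_balanced.
split=> [mono v v' _|ham].
  exact/balanced_lex_succ_hamming/haper/ones_lex_mono_balanced.
by apply/balanced_sturmian => //; apply/ones_lex_mono_balanced/lex_succ_hamming_mono.
Qed.
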